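(* For all integers $m\geq 1$, $n\geq 0$, $p\geq 0$ and every real $x$, \[ m^{n-1}\sum_{k=0}^{m-1}B_{n,p}\!\left(x+\frac{k}{m}\right)=(p+1)\,B_{n}(mx)-p\sum_{k=0}^{n}\binom{n}{k}\frac{m^{k}\,B_{n-k}(mx)\,B_{k,p}}{k+1}. \]
   Context: The Bernoulli polynomials are defined by $\sum_{n\ge0}B_n(x)\frac{t^n}{n!}=\frac{te^{xt}}{e^t-1}$. For each integer $p\geq 0$, the $p$-Bernoulli numbers $B_{n,p}$ are defined by $B_{0,p}=1$ and $B_{n+1,p}=pB_{n,p}-\frac{(p+1)^{2}}{p+2}B_{n,p+1}$ ($n,p\ge 0$), and the $p$-Bernoulli polynomials by $B_{n,p}(x)=\sum_{k=0}^{n}\binom{n}{k}x^{n-k}B_{k,p}$. *)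

(* Defs.v *)
From Stdlib Require Import Reals ZArith.
From Coquelicot Require Import Coquelicot.
Open Scope R_scope.

(* [B n x] is the value at [x] of the [n]-th Bernoulli polynomial: near t = 0,
     sum_n B_n(x) t^n / n! = t e^(xt) / (e^t - 1).
   t = 0 is excluded because the right-hand side is only defined there by
   continuity. The predicate determines B. *)
Definition is_bernoulli (B : nat -> R -> R) : Prop :=
  forall x : R, exists r : R, 0 < r /\
    forall t : R, 0 < Rabs t < r ->
      is_pseries (fun n : nat => B n x / INR (fact n)) t
        (t * exp (x * t) / (exp t - 1)).

Fixpoint pbernoulli (n p : nat) : R :=
  match n with
  | O => 1
  | S n' => INR p * pbernoulli n' p
            - (INR p + 1) ^ 2 / (INR p + 2) * pbernoulli n' (S p)
  end.

(* [Binomial.C] is qualified because Coquelicot uses [C] for the complex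
   numbers; [sum_f_R0 f n] is the sum of f 0, ..., f n. *)
Definition pbernoulli_poly (n p : nat) (x : R) : R :=
  sum_f_R0 (fun k : nat => Binomial.C n k * x ^ (n - k) * pbernoulli k p) n.

(* Main.v *)
(** Everything is an identity between exponential generating functions, i.e.
    sequences under binomial convolution, for which the shift is a derivation.
    Let F_p be the generating function of the B_{n,p}.  By the recurrence,
    G_p = (e^u - 1) F_p' + (e^u + p) F_p - (p + 1) satisfies
    G_p' = (p + 1) G_p - (p + 1)^2 / (p + 2) G_{p+1} and G_p(0) = 0, so it
    vanishes; integrating, (e^u - 1) F_p(u) = (p + 1) u - p int_0^u F_p.
    With u = m t, multiplying both sides of the theorem by e^t - 1 telescopes
    the sum on the left into e^(m t) - 1 and turns the Bernoulli generating
    function on the right into t e^(m x t).  Finally e^t - 1 is cancelled. *)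

Require Import Defs.
From Stdlib Require Import Reals ZArith Lra Lia FunctionalExtensionality.
From Coquelicot Require Import Coquelicot.
Open Scope R_scope.

(** * The ring of exponential generating functions *)

Definition egf_mul (a b : nat -> R) (n : nat) : R :=
  sum_f_R0 (fun k => Binomial.C n k * (a k * b (n - k)%nat)) n.
Definition egf_add (a b : nat -> R) (n : nat) : R := a n + b n.
Definition egf_opp (a : nat -> R) (n : nat) : R := - a n.
Definition egf_sub (a b : nat -> R) (n : nat) : R := a n - b n.
Definition egf_const (c : R) (n : nat) : R := match n with O => c | S _ => 0 end.
Definition egf_X (n : nat) : R := match n with S O => 1 | _ => 0 end.
Definition egf_exp (c : R) (n : nat) : R := c ^ n.
(** Differentiation in t. *)
Definition egf_shift (a : nat -> R) (n : nat) : R := a (S n).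
(** Substitution of c t for t. *)
Definition egf_scale (c : R) (a : nat -> R) (n : nat) : R := c ^ n * a n.

Declare Scope egf_scope.
Delimit Scope egf_scope with egf.
Infix "+" := egf_add : egf_scope.
Infix "-" := egf_sub : egf_scope.
Infix "*" := egf_mul : egf_scope.

Definition egf_expm1 : nat -> R := (egf_exp 1 - egf_const 1)%egf.

Lemma binomial_C_0 n : Binomial.C n 0 = 1.
Proof.
  unfold Binomial.C. rewrite Nat.sub_0_r. simpl.
  field. apply INR_fact_neq_0.
Qed.

Lemma binomial_C_diag n : Binomial.C n n = 1.
Proof.
  unfold Binomial.C. rewrite Nat.sub_diag. simpl.
  field. apply INR_fact_neq_0.
Qed.

Lemma egf_mul_0 a b : egf_mul a b 0 = a 0%nat * b 0%nat.
Proof. unfold egf_mul. simpl. rewrite binomial_C_0. ring. Qed.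

(** The Leibniz rule: Pascal's rule splits every coefficient except the two extreme ones. It lets
    the ring laws be proved by induction on the index, without double sums. *)
Lemma egf_mul_S a b n :
  egf_mul a b (S n) = egf_mul (egf_shift a) b n + egf_mul a (egf_shift b) n.
Proof.
  unfold egf_mul, egf_shift.
  destruct n as [|q].
  { simpl. rewrite !binomial_C_0, binomial_C_diag. ring. }
  rewrite (decomp_sum _ (S (S q))) by lia.
  rewrite (decomp_sum (fun k => _ * (a k * _)) (S q)) by lia.
  simpl pred. rewrite !tech5, !binomial_C_0, !binomial_C_diag, !Nat.sub_diag.
  rewrite (sum_eq _ (fun k => Binomial.C (S q) k * (a (S k) * b (S q - k)%nat)
      + Binomial.C (S q) (S k) * (a (S k) * b (S (S q - S k)))) q).
  - rewrite sum_plus, !Nat.sub_0_r. ring.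
  - intros k Hk. rewrite <- pascal by lia.
    replace (S (S q) - S k)%nat with (S q - k)%nat by lia.
    replace (S (S q - S k)) with (S q - k)%nat by lia. ring.
Qed.

Lemma egf_mul_plus_l a b c n : egf_mul (a + b)%egf c n = egf_mul a c n + egf_mul b c n.
Proof.
  unfold egf_mul, egf_add. rewrite <- sum_plus.
  apply sum_eq; intros; ring.
Qed.

Lemma egf_mul_comm a b : egf_mul a b = egf_mul b a.
Proof.
  extensionality n. revert a b. induction n as [|n IH]; intros a b.
  - rewrite !egf_mul_0. ring.
  - rewrite !egf_mul_S, (IH (egf_shift a)), (IH a). ring.
Qed.

Lemma egf_shift_mul a b :
  egf_shift (egf_mul a b) = (egf_shift a * b + a * egf_shift b)%egf.
Proof. extensionality n. apply egf_mul_S. Qed.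

Lemma egf_mul_plus_r a b c n : egf_mul a (b + c)%egf n = egf_mul a b n + egf_mul a c n.
Proof. rewrite !(egf_mul_comm a). apply egf_mul_plus_l. Qed.

Lemma egf_mul_assoc a b c : egf_mul a (egf_mul b c) = egf_mul (egf_mul a b) c.
Proof.
  extensionality n. revert a b c. induction n as [|n IH]; intros a b c.
  - rewrite !egf_mul_0. ring.
  - rewrite !egf_mul_S, !egf_shift_mul, egf_mul_plus_l, egf_mul_plus_r, !IH. ring.
Qed.

Lemma egf_shift_const c : egf_shift (egf_const c) = egf_const 0.
Proof. extensionality n. now destruct n. Qed.

Lemma egf_mul_const c a n : egf_mul (egf_const c) a n = c * a n.
Proof.
  revert c a. induction n as [|n IH]; intros c a.
  - now rewrite egf_mul_0.
  - rewrite egf_mul_S, egf_shift_const, !IH. unfold egf_shift. ring.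
Qed.

(** Series are compared with [eq], by functional extensionality, so [ring] then applies to
    identities between whole series. *)
Lemma egf_ring_theory :
  ring_theory (egf_const 0) (egf_const 1) egf_add egf_mul egf_sub egf_opp eq.
Proof.
  split; intros.
  - extensionality n; destruct n; unfold egf_add; simpl; ring.
  - extensionality n; unfold egf_add; ring.
  - extensionality n; unfold egf_add; ring.
  - extensionality n; rewrite egf_mul_const; ring.
  - apply egf_mul_comm.
  - apply egf_mul_assoc.
  - extensionality n; apply egf_mul_plus_l.
  - reflexivity.
  - extensionality n; destruct n; unfold egf_add, egf_opp; simpl; ring.
Qed.
Add Ring egf_ring : egf_ring_theory.

Lemma egf_mul_X a n : egf_mul egf_X a (S n) = INR (S n) * a n.
Proof.
  assert (HX : egf_shift egf_X = egf_const 1) by (extensionality k; now destruct k).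
  revert a. induction n as [|n IH]; intros a; rewrite egf_mul_S, HX, egf_mul_const.
  - rewrite egf_mul_0. simpl. ring.
  - rewrite IH, (S_INR (S n)). unfold egf_shift. ring.
Qed.

Lemma egf_shift_exp c : egf_shift (egf_exp c) = (egf_const c * egf_exp c)%egf.
Proof. extensionality n. now rewrite egf_mul_const. Qed.

(** Both sides have constant term 1 and solve f' = (x + y) f. *)
Lemma egf_mul_exp x y : (egf_exp x * egf_exp y)%egf = egf_exp (x + y).
Proof.
  extensionality n. induction n as [|n IH].
  - rewrite egf_mul_0. unfold egf_exp. simpl. ring.
  - rewrite egf_mul_S, !egf_shift_exp.
    replace (egf_exp x * (egf_const y * egf_exp y))%egf
      with (egf_const y * (egf_exp x * egf_exp y))%egf by ring.
    rewrite <- egf_mul_assoc, !egf_mul_const, IH. unfold egf_exp. simpl. ring.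
Qed.

Lemma egf_scale_exp c x : egf_scale c (egf_exp x) = egf_exp (c * x).
Proof. extensionality n. unfold egf_scale, egf_exp. now rewrite Rpow_mult_distr. Qed.

Lemma egf_scale_mul c a b :
  egf_scale c (a * b)%egf = (egf_scale c a * egf_scale c b)%egf.
Proof.
  extensionality n. unfold egf_scale, egf_mul.
  rewrite scal_sum. apply sum_eq. intros k Hk.
  replace (c ^ n) with (c ^ k * c ^ (n - k)) by (rewrite <- pow_add; f_equal; lia).
  ring.
Qed.

(** As e^t - 1 = t + ..., the coefficient of index n + 1 of the product is (n + 1) a_n plus terms in
    earlier a_k, so strong induction recovers a_n. *)
Lemma egf_expm1_cancel a b : (egf_expm1 * a)%egf = (egf_expm1 * b)%egf -> a = b.
Proof.
  intros H. extensionality n. induction n as [n IH] using (well_founded_induction lt_wf).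
  assert (Hn := f_equal (fun f => f (S n)) H). simpl in Hn.
  (* With [egf_expm1] as right factor, the last two terms of the sum carry its coefficients 1 and
     0. *)
  rewrite !(egf_mul_comm egf_expm1) in Hn. unfold egf_mul in Hn.
  rewrite !tech5, Nat.sub_diag in Hn.
  destruct n as [|q].
  - simpl in Hn. unfold egf_expm1, egf_sub, egf_exp in Hn. simpl in Hn.
    rewrite binomial_C_0 in Hn. lra.
  - rewrite !(tech5 _ q) in Hn.
    rewrite (sum_eq (fun k => _ * (b k * _))
               (fun k => Binomial.C (S (S q)) k * (a k * egf_expm1 (S (S q) - k)%nat)) q) in Hn
      by (intros k Hk; rewrite IH by lia; reflexivity).
    replace (S (S q) - S q)%nat with 1%nat in Hn by lia.
    assert (E0 : egf_expm1 0 = 0) by (unfold egf_expm1, egf_sub, egf_exp; simpl; ring).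
    assert (E1 : egf_expm1 1 = 1) by (unfold egf_expm1, egf_sub, egf_exp; simpl; ring).
    rewrite E0, E1 in Hn.
    assert (HC : Binomial.C (S (S q)) (S q) <> 0).
    { unfold Binomial.C. apply Rmult_integral_contrapositive_currified.
      - apply INR_fact_neq_0.
      - apply Rinv_neq_0_compat, Rmult_integral_contrapositive_currified;
          apply INR_fact_neq_0. }
    apply (Rmult_eq_reg_l (Binomial.C (S (S q)) (S q))); [lra | exact HC].
Qed.

(** * Functional equation of the p-Bernoulli generating function *)

Definition egf_pbernoulli (p n : nat) : R := pbernoulli n p.

Lemma egf_shift_pbernoulli p :
  egf_shift (egf_pbernoulli p)
  = (egf_const (INR p) * egf_pbernoulli p
     - egf_const ((INR p + 1) ^ 2 / (INR p + 2)) * egf_pbernoulli (S p))%egf.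
Proof. extensionality n. unfold egf_sub. now rewrite !egf_mul_const. Qed.

Lemma egf_shift_expm1 : egf_shift egf_expm1 = egf_exp 1.
Proof.
  extensionality n. unfold egf_shift, egf_expm1, egf_sub, egf_exp. simpl. ring.
Qed.

Lemma egf_shift_lin c d a b :
  egf_shift (egf_const c * a - egf_const d * b)%egf
  = (egf_const c * egf_shift a - egf_const d * egf_shift b)%egf.
Proof. extensionality n. unfold egf_sub, egf_shift. now rewrite !egf_mul_const. Qed.

Lemma egf_mul_lin e c d a b n :
  egf_mul e (egf_const c * a - egf_const d * b)%egf n
  = c * egf_mul e a n - d * egf_mul e b n.
Proof.
  replace (e * (egf_const c * a - egf_const d * b))%egf
    with (egf_const c * (e * a) - egf_const d * (e * b))%egf by ring.
  unfold egf_sub. now rewrite !egf_mul_const.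
Qed.

(** This is G_p = 0, coefficient by coefficient. The induction keeps p general because G_p' involves
    G_{p+1}. *)
Lemma pbernoulli_ode n p :
  egf_mul egf_expm1 (egf_shift (egf_pbernoulli p)) n
  + egf_mul (egf_exp 1) (egf_pbernoulli p) n + INR p * pbernoulli n p
  = egf_const (INR p + 1) n.
Proof.
  revert p. induction n as [|n IH]; intros p.
  - rewrite !egf_mul_0. unfold egf_expm1, egf_sub, egf_exp, egf_pbernoulli. simpl. ring.
  - rewrite (egf_mul_S egf_expm1), (egf_mul_S (egf_exp 1)), egf_shift_expm1,
      (egf_shift_exp 1).
    replace (egf_const 1 * egf_exp 1)%egf with (egf_exp 1) by ring.
    assert (H1 := IH p). assert (H2 := IH (S p)).
    assert (HF : pbernoulli (S n) p = INR p * pbernoulli n p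
              - (INR p + 1) ^ 2 / (INR p + 2) * pbernoulli n (S p)) by reflexivity.
    assert (HE : egf_mul (egf_exp 1) (egf_shift (egf_pbernoulli p)) n
      = INR p * egf_mul (egf_exp 1) (egf_pbernoulli p) n
        - (INR p + 1) ^ 2 / (INR p + 2) * egf_mul (egf_exp 1) (egf_pbernoulli (S p)) n)
      by (rewrite egf_shift_pbernoulli; apply egf_mul_lin).
    assert (HA : egf_mul egf_expm1 (egf_shift (egf_shift (egf_pbernoulli p))) n
      = INR p * egf_mul egf_expm1 (egf_shift (egf_pbernoulli p)) n
        - (INR p + 1) ^ 2 / (INR p + 2)
          * egf_mul egf_expm1 (egf_shift (egf_pbernoulli (S p))) n)
      by (rewrite (egf_shift_pbernoulli p) at 1; rewrite egf_shift_lin; apply egf_mul_lin).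
    (* A second expression for the first term of [H1]: e^u - 1 acts as e^u minus identity. *)
    assert (HD : egf_mul egf_expm1 (egf_shift (egf_pbernoulli p)) n
      = egf_mul (egf_exp 1) (egf_shift (egf_pbernoulli p)) n - pbernoulli (S n) p).
    { unfold egf_expm1.
      replace ((egf_exp 1 - egf_const 1) * egf_shift (egf_pbernoulli p))%egf
        with (egf_exp 1 * egf_shift (egf_pbernoulli p) - egf_shift (egf_pbernoulli p))%egf
        by ring.
      reflexivity. }
    rewrite HF, HE in HD. rewrite HF, HE, HA.
    assert (Hc : (INR p + 1) ^ 2 / (INR p + 2) * (INR p + 2) = (INR p + 1) ^ 2)
      by (field; generalize (pos_INR p); lra).
    (* Only c (p + 2) = (p + 1)^2 is kept. The goal is then (p + 1) [H1] - c [H2], corrected by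
       [HD]; the constants cancel by [Hc]. Once these products are expanded, the rest is linear in
       the monomials. *)
    set (c := (INR p + 1) ^ 2 / (INR p + 2)) in *. clearbody c.
    rewrite S_INR in H2.
    assert (Hd1 : egf_const (INR p + 1) n = (INR p + 1) * egf_const 1 n)
      by (destruct n; simpl; ring).
    assert (Hd2 : egf_const (INR p + 1 + 1) n = (INR p + 2) * egf_const 1 n)
      by (destruct n; simpl; ring).
    rewrite Hd1 in H1. rewrite Hd2 in H2. simpl egf_const.
    apply (f_equal (Rmult (INR p + 1))) in H1. apply (f_equal (Rmult c)) in H2.
    apply (f_equal (Rmult (egf_const 1 n))) in Hc.
    ring_simplify in H1. ring_simplify in H2. ring_simplify in Hc. ring_simplify.
    lra.
Qed.

(* The generating function of p + 1 - (p / u) int_0^u F_p. *)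
Definition egf_cofactor (p : nat) (n : nat) : R :=
  egf_const (INR p + 1) n - INR p * (pbernoulli n p / (INR n + 1)).

(** By [pbernoulli_ode], the left side has derivative p + 1 - p F_p. Multiplication by u contributes
    the factor n + 1 that cancels the denominator in the cofactor. *)
Lemma pbernoulli_functional_equation p :
  (egf_expm1 * egf_pbernoulli p)%egf = (egf_X * egf_cofactor p)%egf.
Proof.
  extensionality n. destruct n as [|n].
  - rewrite !egf_mul_0. unfold egf_expm1, egf_sub, egf_exp. simpl. ring.
  - rewrite egf_mul_S, egf_shift_expm1, egf_mul_X.
    assert (H := pbernoulli_ode n p).
    (* The constant series is supported at n = 0, where the factor n + 1 is 1. *)
    assert (Hd : INR (S n) * egf_const (INR p + 1) n = egf_const (INR p + 1) n)
      by (destruct n; simpl; ring).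
    unfold egf_cofactor. rewrite Rmult_minus_distr_l, Hd.
    replace (INR (S n) * (INR p * (pbernoulli n p / (INR n + 1))))
      with (INR p * pbernoulli n p).
    + lra.
    + rewrite S_INR. field. generalize (pos_INR n). lra.
Qed.

(** * From convergent power series to coefficient sequences *)

Lemma PS_mult_egf a b n :
  PS_mult (fun k => a k / INR (fact k)) (fun k => b k / INR (fact k)) n
  = egf_mul a b n / INR (fact n).
Proof.
  unfold PS_mult, egf_mul, Rdiv at 3. rewrite Rmult_comm, scal_sum.
  apply sum_eq. intros k Hk. unfold Binomial.C. field.
  repeat split; apply INR_fact_neq_0.
Qed.

(** Were the radius below |u|, the terms at u would not tend to 0, contradicting convergence
    there. *)
Lemma CV_radius_gt (a : nat -> R) t u l :
  is_pseries a u l -> Rabs t < Rabs u -> Rbar_lt (Rabs t) (CV_radius a).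
Proof.
  intros Hu Htu. apply Rbar_lt_le_trans with (Rabs u); [exact Htu|].
  apply Rbar_not_lt_le. intros Hlt.
  apply (CV_disk_outside _ _ Hlt), ex_series_lim_0.
  exists l. apply is_pseries_R, Hu.
Qed.

(* [t = 0] is excluded, as in [is_bernoulli]. *)
Definition egf_sums (a : nat -> R) (r : R) (f : R -> R) : Prop :=
  forall t, 0 < Rabs t < r -> is_pseries (fun n => a n / INR (fact n)) t (f t).

Lemma egf_sums_CV_radius a r f t :
  0 < r -> egf_sums a r f -> Rabs t < r ->
  Rbar_lt (Rabs t) (CV_radius (fun n => a n / INR (fact n))).
Proof.
  intros Hr Ha Ht. assert (H0 := Rabs_pos t).
  assert (Hu : Rabs ((Rabs t + r) / 2) = (Rabs t + r) / 2) by (apply Rabs_pos_eq; lra).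
  (* The midpoint of |t| and r is nonzero even when t = 0, so it lies in the punctured disc. *)
  apply (CV_radius_gt _ _ ((Rabs t + r) / 2) (f ((Rabs t + r) / 2))).
  - apply Ha. lra.
  - lra.
Qed.

Lemma egf_sums_mul a b r f g :
  egf_sums a r f -> egf_sums b r g -> egf_sums (a * b)%egf r (fun t => f t * g t).
Proof.
  intros Ha Hb t Ht.
  apply is_pseries_ext with
    (PS_mult (fun k => a k / INR (fact k)) (fun k => b k / INR (fact k))).
  { intros n. apply PS_mult_egf. }
  apply is_pseries_mult; auto.
  - apply egf_sums_CV_radius with r f; auto; lra.
  - apply egf_sums_CV_radius with r g; auto; lra.
Qed.

(** Sums are prescribed only away from 0, so the constant terms are compared separately; the power
    series then agree near 0, hence so do their coefficients. *)
Lemma egf_sums_unique a b r f :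
  0 < r -> a 0%nat = b 0%nat -> egf_sums a r f -> egf_sums b r f -> a = b.
Proof.
  intros Hr H0 Ha Hb. extensionality n.
  assert (Hn : a n / INR (fact n) = b n / INR (fact n)).
  { apply (PSeries_ext_recip (fun k => a k / INR (fact k)) (fun k => b k / INR (fact k))).
    - rewrite <- Rabs_R0. apply egf_sums_CV_radius with r f; auto. now rewrite Rabs_R0.
    - rewrite <- Rabs_R0. apply egf_sums_CV_radius with r f; auto. now rewrite Rabs_R0.
    - exists (mkposreal r Hr). intros t Ht.
      change (Rabs (t - 0) < r) in Ht. rewrite Rminus_0_r in Ht.
      destruct (Req_dec t 0) as [->|Hne].
      + rewrite !PSeries_0, H0. reflexivity.
      + assert (Ht' : 0 < Rabs t < r) by (split; [now apply Rabs_pos_lt | exact Ht]).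
        rewrite (is_pseries_unique _ _ _ (Ha t Ht')), (is_pseries_unique _ _ _ (Hb t Ht')).
        reflexivity. }
  apply (Rmult_eq_reg_r (/ INR (fact n))); [exact Hn|].
  apply Rinv_neq_0_compat, INR_fact_neq_0.
Qed.

Lemma egf_sums_exp c r : egf_sums (egf_exp c) r (fun t => exp (c * t)).
Proof.
  intros t _. apply is_pseries_R.
  apply is_series_ext with (fun n => / INR (fact n) * (c * t) ^ n).
  - intros n. change (/ INR (fact n) * (c * t) ^ n = c ^ n / INR (fact n) * t ^ n).
    rewrite Rpow_mult_distr. unfold Rdiv. ring.
  - apply is_pseries_R, is_exp_Reals.
Qed.

Lemma is_series_finite (a : nat -> R) N l :
  (forall n, (N < n)%nat -> a n = 0) -> sum_n a N = l -> is_series a l.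
Proof.
  intros Ha <-. change (is_lim_seq (sum_n a) (sum_n a N)).
  apply (is_lim_seq_ext_loc (fun _ => sum_n a N)).
  - exists N. intros n Hn. induction Hn as [|n Hn IH]; [reflexivity|].
    rewrite sum_Sn, <- IH, Ha by lia. symmetry. exact (Rplus_0_r _).
  - apply is_lim_seq_const.
Qed.

Lemma egf_sums_const c r : egf_sums (egf_const c) r (fun _ => c).
Proof.
  intros t _. apply is_pseries_R.
  apply (is_series_finite _ 0).
  - intros [|n] Hn; [lia|]. simpl. unfold Rdiv. ring.
  - rewrite sum_O. simpl. field.
Qed.

Lemma egf_sums_X r : egf_sums egf_X r (fun t => t).
Proof.
  intros t _. apply is_pseries_R.
  apply (is_series_finite _ 1).
  - intros [|[|n]] Hn; try lia. simpl egf_X. unfold Rdiv. ring.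
  - rewrite sum_Sn, sum_O. unfold plus. simpl. field.
Qed.

Lemma egf_sums_expm1 r : egf_sums egf_expm1 r (fun t => exp t - 1).
Proof.
  intros t Ht.
  assert (H1 := egf_sums_exp 1 r t Ht). assert (H2 := egf_sums_const 1 r t Ht).
  simpl in H1. rewrite Rmult_1_l in H1.
  eapply is_pseries_ext; [|exact (is_pseries_minus _ _ _ _ _ H1 H2)].
  intros n. unfold egf_expm1, egf_sub, PS_minus, PS_plus, PS_opp, plus, opp. simpl.
  unfold Rdiv. ring.
Qed.

(** Both sides have constant term 0 and sum to t e^(y t) on a punctured disc. *)
Lemma bernoulli_functional_equation B y :
  is_bernoulli B ->
  (egf_expm1 * (fun n => B n y))%egf = (egf_X * egf_exp y)%egf.
Proof.
  intros HB. destruct (HB y) as [r [Hr HP]].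
  apply (egf_sums_unique _ _ r (fun t => t * exp (y * t))); auto.
  - rewrite !egf_mul_0. unfold egf_expm1, egf_sub, egf_exp. simpl. ring.
  - intros t Ht.
    replace (t * exp (y * t)) with ((exp t - 1) * (t * exp (y * t) / (exp t - 1))).
    + exact (egf_sums_mul _ _ _ _ _ (egf_sums_expm1 r) HP t Ht).
    (* The denominator e^t - 1 vanishes only at the excluded point t = 0. *)
    + field. intros H. assert (Ht0 : t = 0).
      { apply exp_inv. rewrite exp_0. lra. }
      rewrite Ht0, Rabs_R0 in Ht. lra.
  - exact (egf_sums_mul _ _ _ _ _ (egf_sums_X r) (egf_sums_exp y r)).
Qed.

(** * Telescoping and the multiplication formula *)

Lemma telescoped_sum P q :
  (egf_expm1 * (fun n => sum_f_R0 (fun k => egf_mul P (egf_exp (INR k)) n) q))%egf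
  = (P * (egf_exp (INR (S q)) - egf_const 1))%egf.
Proof.
  assert (Hstep : forall k, (egf_expm1 * (P * egf_exp (INR k)))%egf
            = (P * egf_exp (INR (S k)) - P * egf_exp (INR k))%egf).
  { intros k. rewrite S_INR, (Rplus_comm (INR k)), <- egf_mul_exp.
    unfold egf_expm1. ring. }
  induction q as [|q IH].
  - replace (fun n => sum_f_R0 (fun k => egf_mul P (egf_exp (INR k)) n) 0)
      with (P * egf_exp (INR 0))%egf by reflexivity.
    rewrite Hstep.
    replace (egf_exp (INR 0)) with (egf_const 1).
    + ring.
    (* The constant term relies on 0 ^ 0 = 1. *)
    + extensionality n; destruct n; unfold egf_exp; simpl; ring.
  - replace (fun n => sum_f_R0 (fun k => egf_mul P (egf_exp (INR k)) n) (S q))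
      with ((fun n => sum_f_R0 (fun k => egf_mul P (egf_exp (INR k)) n) q)
            + P * egf_exp (INR (S q)))%egf by reflexivity.
    transitivity (egf_expm1 * (fun n => sum_f_R0 (fun k => egf_mul P (egf_exp (INR k)) n) q)
                  + egf_expm1 * (P * egf_exp (INR (S q))))%egf; [ring|].
    rewrite IH, Hstep. ring.
Qed.

(** The B_{n,p}(y) have generating function F_p(t) e^(y t); replacing t by m t at y = x + k/m gives
    F_p(m t) e^(m x t) e^(k t). *)
Lemma pbernoulli_poly_scale m n p x k :
  m <> 0 ->
  m ^ n * pbernoulli_poly n p (x + k / m)
  = egf_mul (egf_scale m (egf_pbernoulli p) * egf_exp (m * x))%egf (egf_exp k) n.
Proof.
  intros Hm. rewrite <- egf_mul_assoc, egf_mul_exp.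
  replace (m * x + k) with (m * (x + k / m)) by (field; exact Hm).
  rewrite <- egf_scale_exp, <- egf_scale_mul. unfold egf_scale at 1. f_equal.
  unfold pbernoulli_poly, egf_mul. apply sum_eq. intros i Hi.
  unfold egf_exp, egf_pbernoulli. ring.
Qed.

Theorem theorem4 (B : nat -> R -> R) (HB : is_bernoulli B)
    (m n p : nat) (hm : (1 <= m)%nat) (x : R) :
  powerRZ (INR m) (Z.of_nat n - 1)
    * sum_f_R0 (fun k : nat => pbernoulli_poly n p (x + INR k / INR m)) (m - 1)
  = (INR p + 1) * B n (INR m * x)
    - INR p * sum_f_R0 (fun k : nat =>
        Binomial.C n k
          * (INR m ^ k * B (n - k)%nat (INR m * x) * pbernoulli k p / (INR k + 1))) n.
Proof.
  destruct m as [|q]; [lia|]. replace (S q - 1)%nat with q by lia.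
  assert (Hm : INR (S q) <> 0) by (apply not_0_INR; lia).
  assert (HS := telescoped_sum
    (egf_scale (INR (S q)) (egf_pbernoulli p) * egf_exp (INR (S q) * x))%egf q).
  set (m := INR (S q)) in *.
  assert (Hb := bernoulli_functional_equation B (m * x) HB).
  set (b := fun n => B n (m * x)) in *.
  (* The functional equation of F_p at u = m t. *)
  assert (Hscale : (egf_scale m (egf_pbernoulli p) * (egf_exp m - egf_const 1))%egf
            = (egf_const m * egf_X * egf_scale m (egf_cofactor p))%egf).
  { transitivity (egf_scale m (egf_expm1 * egf_pbernoulli p)%egf).
    - rewrite egf_scale_mul, egf_mul_comm. f_equal.
      extensionality k. unfold egf_scale, egf_expm1, egf_sub, egf_exp.
      destruct k; simpl; [ring|]. rewrite pow1. ring.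
    - rewrite pbernoulli_functional_equation, egf_scale_mul. f_equal.
      extensionality k. rewrite egf_mul_const. unfold egf_scale.
      destruct k as [|[|k]]; simpl; ring. }
  (* After multiplication by e^t - 1, both sides equal m t e^(m x t) times the cofactor at m t. *)
  assert (Hmain : (fun n => sum_f_R0 (fun k => egf_mul
      (egf_scale m (egf_pbernoulli p) * egf_exp (m * x))%egf (egf_exp (INR k)) n) q)
      = (egf_const m * (egf_scale m (egf_cofactor p) * b))%egf).
  { apply egf_expm1_cancel. rewrite HS.
    transitivity (egf_const m * egf_scale m (egf_cofactor p) * (egf_expm1 * b))%egf;
      [|ring].
    rewrite Hb.
    transitivity (egf_exp (m * x)
      * (egf_scale m (egf_pbernoulli p) * (egf_exp m - egf_const 1)))%egf; [ring|].
    rewrite Hscale. ring. }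
  apply (f_equal (fun f => f n)) in Hmain. simpl in Hmain.
  rewrite egf_mul_const in Hmain.
  rewrite (sum_eq _ (fun k => pbernoulli_poly n p (x + INR k / m) * m ^ n)) in Hmain
    by (intros k _; rewrite <- pbernoulli_poly_scale by exact Hm; ring).
  rewrite <- scal_sum in Hmain.
  (* The exponent n - 1 is -1 when n = 0, so m^(n-1) is split as m^n / m; the 1/m cancels the factor
     m of [Hmain]. *)
  unfold Z.sub. rewrite powerRZ_add by exact Hm.
  rewrite <- pow_powerRZ.
  transitivity (/ m * (m ^ n * sum_f_R0 (fun k => pbernoulli_poly n p (x + INR k / m)) q)).
  { change (- (1))%Z with (-1)%Z. simpl. rewrite Rmult_1_r. ring. }
  rewrite Hmain, <- Rmult_assoc, Rinv_l, Rmult_1_l by exact Hm.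
  (* The cofactor at m t is put in the shape of [egf_mul_lin], its constant part being a multiple of
     the unit series; this yields the two terms of the right-hand side. *)
  replace (egf_scale m (egf_cofactor p))
    with (egf_const (INR p + 1) * egf_const 1
          - egf_const (INR p) * (fun k => m ^ k * (pbernoulli k p / (INR k + 1)))%R)%egf.
  - rewrite egf_mul_comm, egf_mul_lin, !(egf_mul_comm b), egf_mul_const, Rmult_1_l.
    unfold b at 1. f_equal. f_equal. unfold egf_mul. apply sum_eq.
    intros k _. unfold b, Rdiv. ring.
  - extensionality k. unfold egf_sub. rewrite !egf_mul_const.
    unfold egf_scale, egf_cofactor. destruct k; simpl; ring.
Qed.
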